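(* For every $n\ge 0$, $$\sum_{\sigma\in\mathfrak S_n} s^{\mathrm{lec}\,\sigma}\,t^{\mathrm{ides}\,\sigma}\,q^{\mathrm{imaj}\,\sigma}\,Y^{\mathrm{pix}\,\sigma}=A_n(s,t,q,Y),$$ where the polynomials $A_n(s,t,q,Y)$ are defined by the identity of formal power series $$\sum_{r\ge 0}t^r\,\frac{(1-qs)\,(u;q)_r\,(usq;q)_r}{\bigl((u;q)_r-sq\,(usq;q)_r\bigr)\,(uY;q)_{r+1}}=\sum_{n\ge 0}A_n(s,t,q,Y)\,\frac{u^n}{(t;q)_{n+1}}.$$
   Context: $(a;q)_0=1$, $(a;q)_n=(1-a)(1-aq)\cdots(1-aq^{n-1})$. For $\sigma\in\mathfrak S_n$: $\mathrm{des}\,\sigma=\#\{i\le n-1:\sigma(i)>\sigma(i+1)\}$, $\mathrm{maj}\,\sigma=\sum_{i\le n-1,\ \sigma(i)>\sigma(i+1)} i$, $\mathrm{ides}\,\sigma=\mathrm{des}\,\sigma^{-1}$, $\mathrm{imaj}\,\sigma=\mathrm{maj}\,\sigma^{-1}$. A hook is a word $x_1\cdots x_m$ of distinct positive integers with $m\ge2$, $x_1>x_2$, and either $m=2$ or $x_2<x_3<\cdots<x_m$. Every permutation $\sigma$ (as a word $\sigma(1)\cdots\sigma(n)$) has a unique factorization $p\,\tau_1\tau_2\cdots\tau_k$ (its hook factorization) where $p$ is an increasing word (possibly empty) and each $\tau_i$ is a hook. Then $\mathrm{pix}\,\sigma$ is the length of $p$, and $\mathrm{lec}\,\sigma=\sum_{i=1}^k\mathrm{inv}\,\tau_i$,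 where $\mathrm{inv}$ of a word is its number of pairs of positions $a<b$ with the letter at $a$ greater than the letter at $b$. *)

(* Defs.v *)
From HB Require Import structures.
From mathcomp Require Import all_boot all_order all_fingroup all_algebra.
From mathcomp Require Import boolp.
From mathcomp Require Import mpoly.

Set Implicit Arguments.
Unset Strict Implicit.
Unset Printing Implicit Defensive.

Import GRing.Theory.

Section Words.
Local Open Scope nat_scope.
Implicit Types (w p : seq nat) (hs : seq (seq nat)).

(* Positions are numbered from 1 to [size w] as in the usual definition of the
   major index: the letter at position [i] is [nth 0 w i.-1]. *)
Definition is_descent w i := nth 0 w i.-1 > nth 0 w i.
Definition desw w := \sum_(1 <= i < size w | is_descent w i) 1.
Definition majw w := \sum_(1 <= i < size w | is_descent w i) i.

Definition invw w :=
  \sum_(a < size w) \sum_(b < size w | (a < b) && (nth 0 w a > nth 0 w b)) 1.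

Definition increasing w := sorted ltn w.

Definition is_hook w :=
  if w is x1 :: x2 :: w' then
    [&& uniq w, all (ltn 0) w, x2 < x1 & increasing (x2 :: w')]
  else false.

Definition hook_factorization w (ph : seq nat * seq (seq nat)) :=
  [&& w == ph.1 ++ flatten ph.2, increasing ph.1 & all is_hook ph.2].

Lemma hook_factorization_exists w :
  uniq w && all (ltn 0) w -> exists ph, hook_factorization w ph.
Proof.
elim: w => [_|x w IHw]; first by exists ([::], [::]).
move=> /andP[/= /andP[xw uw] /andP[x0 w0]].
have [|[[|y p] hs]] := IHw; first by rewrite uw.
  rewrite /hook_factorization /= => /andP[/eqP-> hhs].
  by exists ([:: x], hs); rewrite /= eqxx.
rewrite /hook_factorization /= => /and3P[/eqP def_w yp hhs].
have [xy|yx|xy] := ltngtP x y.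
- by exists (x :: y :: p, hs); rewrite def_w /= eqxx xy yp.
- exists ([::], (x :: y :: p) :: hs); rewrite def_w /= eqxx yx yp x0 hhs !andbT.
  have uyp: uniq (y :: p) by move: uw; rewrite def_w -cat_cons cat_uniq => /andP[].
  move: xw w0; rewrite def_w -cat_cons mem_cat negb_or all_cat.
  by case/andP=> xyp _ /andP[yp0 _]; move: uyp yp0 xyp => /= -> /= ->; rewrite andbT => ->.
- by move: xw; rewrite def_w xy mem_head.
Qed.

Lemma hook_factorization_unique w ph1 ph2 :
  hook_factorization w ph1 -> hook_factorization w ph2 -> ph1 = ph2.
Proof.
(* the factorization of [w] induced by one of [x :: w] *)
have tail x v p hs : hook_factorization (x :: v) (p, hs) ->
  exists p' hs', hook_factorization v (p', hs') /\
    ((p = x :: p' /\ hs = hs') /\ (p' = [::] \/ x < head 0 p')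
     \/ (p = [::] /\ hs = (x :: p') :: hs') /\ (p' <> [::] /\ head 0 p' < x)).
  rewrite /hook_factorization /=; case: p => [|y p] /=.
    case: hs => [|[|y [|z h]] hs] //=; rewrite ?andbF //.
    move=> /andP[/eqP[-> ->] /andP[/and4P[_ _ zy zh] hhs]].
    exists (z :: h), hs; split; last by right.
    by rewrite /= eqxx zh hhs.
  move=> /and3P[/eqP[-> ->] yp hhs]; exists p, hs; split.
    by rewrite eqxx hhs /increasing (path_sorted yp).
  by left; split=> //; case: (p) yp => [|z p'] /=; [left | case/andP; right].
elim: w ph1 ph2 => [|x w IHw] [p1 hs1] [p2 hs2].
  have nilP p hs : hook_factorization [::] (p, hs) -> (p, hs) = ([::], [::]).
    rewrite /hook_factorization; case: p => [|? ?] //=.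
    by case: hs => [|[|? ?] ?] //=; rewrite andbF.
  by move=> /nilP -> /nilP ->.
move=> /tail[p1' [hs1' [/IHw f1 c1]]] /tail[p2' [hs2' [/f1 [<- <-] c2]]].
case: c1 => [[[-> ->] d1]|[[-> ->] [n1 d1]]];
  case: c2 => [[[-> ->] d2]|[[-> ->] [n2 d2]]] //.
- by case: d1 => // /(ltn_trans d2); rewrite ltnn.
- by case: d2 => // /(ltn_trans d1); rewrite ltnn.
Qed.

End Words.

Section Permutations.
Local Open Scope nat_scope.
Variable n : nat.
Implicit Type sigma : 'S_n.

(* ['S_n] acts on {0, ..., n-1}; letters are shifted to {1, ..., n}. *)
Definition perm_word sigma : seq nat := [seq (sigma i).+1 | i <- enum 'I_n].

Lemma perm_word_ok sigma :
  uniq (perm_word sigma) && all (ltn 0) (perm_word sigma).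
Proof.
rewrite map_inj_uniq ?enum_uniq /=; last by move=> i j [/val_inj/perm_inj].
by apply/allP=> _ /mapP[i _ ->].
Qed.

Definition hookfact sigma : seq nat * seq (seq nat) :=
  xchoose (hook_factorization_exists (perm_word_ok sigma)).

Definition des sigma := desw (perm_word sigma).
Definition maj sigma := majw (perm_word sigma).
Definition ides sigma := des (sigma^-1)%g.
Definition imaj sigma := maj (sigma^-1)%g.
Definition pix sigma := size (hookfact sigma).1.
Definition lec sigma := \sum_(h <- (hookfact sigma).2) invw h.

End Permutations.

Local Open Scope ring_scope.

Record fps (R : Type) := Fps { fcoef : nat -> R }.
Arguments Fps {R}.
Notation "{ 'fps' R }" := (fps R) (at level 0, format "{ 'fps'  R }") : type_scope.

HB.instance Definition _ (R : Type) := gen_eqMixin {fps R}.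
HB.instance Definition _ (R : Type) := gen_choiceMixin {fps R}.

Lemma fpsP (R : Type) (f g : {fps R}) : fcoef f =1 fcoef g <-> f = g.
Proof. by case: f g => [f] [g]; split=> [/funext /= -> | ->]. Qed.

Section FpsZmodule.
Variable R : comNzRingType.
Implicit Types f g h : {fps R}.

Definition fps_zero : {fps R} := Fps (fun=> 0).
Definition fps_opp f := Fps (fun n => - fcoef f n).
Definition fps_add f g := Fps (fun n => fcoef f n + fcoef g n).

Fact fps_addA : associative fps_add.
Proof. by move=> f g h; apply/fpsP=> n /=; rewrite addrA. Qed.
Fact fps_addC : commutative fps_add.
Proof. by move=> f g; apply/fpsP=> n /=; rewrite addrC. Qed.
Fact fps_add0 : left_id fps_zero fps_add.
Proof. by move=> f; apply/fpsP=> n /=; rewrite add0r. Qed.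
Fact fps_addN : left_inverse fps_zero fps_opp fps_add.
Proof. by move=> f; apply/fpsP=> n /=; rewrite addNr. Qed.

HB.instance Definition _ :=
  GRing.isZmodule.Build {fps R} fps_addA fps_addC fps_add0 fps_addN.

Definition fpsC (c : R) : {fps R} := Fps (fun n => if n == 0 then c else 0).
Definition fpsX : {fps R} := Fps (fun n => (n == 1)%:R).

Definition fps_mul f g :=
  Fps (fun n => \sum_(i < n.+1) fcoef f i * fcoef g (n - i)).

(* truncation to degree [< m], used to inherit the ring laws of {poly R} *)
Let trunc m f : {poly R} := \poly_(i < m) fcoef f i.

Let coef_trunc m f i : (i < m)%N -> (trunc m f)`_i = fcoef f i.
Proof. by move=> im; rewrite coef_poly im. Qed.

Let coef_truncM m f g n : (n < m)%N ->
  (trunc m f * trunc m g)`_n = fcoef (fps_mul f g) n.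
Proof.
move=> nm; rewrite coefM; apply: eq_bigr => i _.
have im : (i < m)%N by apply: leq_ltn_trans nm; rewrite -ltnS.
by rewrite !coef_trunc // (leq_ltn_trans (leq_subr _ _)).
Qed.

Let eq_coefM (p p' r r' : {poly R}) n :
    (forall i, (i <= n)%N -> p`_i = p'`_i) ->
    (forall i, (i <= n)%N -> r`_i = r'`_i) ->
  (p * r)`_n = (p' * r')`_n.
Proof.
move=> pp' rr'; rewrite !coefM; apply: eq_bigr => i _.
rewrite pp'; last by rewrite -ltnS.
by rewrite rr' // leq_subr.
Qed.

Fact fps_mulA : associative fps_mul.
Proof.
move=> f g h; apply/fpsP=> n; pose T := trunc n.+1.
have TM f' g' i : (i <= n)%N -> (T (fps_mul f' g'))`_i = (T f' * T g')`_i.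
  by move=> le_in; rewrite coef_trunc // coef_truncM.
rewrite -!(@coef_truncM n.+1) //.
transitivity (T f * (T g * T h))`_n; first exact/eq_coefM/TM.
by rewrite mulrA; apply: eq_coefM => // i /TM ->.
Qed.
Fact fps_mulC : commutative fps_mul.
Proof.
by move=> f g; apply/fpsP=> n; rewrite -!(@coef_truncM n.+1) // mulrC.
Qed.
Fact fps_mul1 : left_id (fpsC 1) fps_mul.
Proof.
move=> f; apply/fpsP=> n /=; rewrite big_ord_recl /= mul1r subn0.
by rewrite big1 ?addr0 // => i _; rewrite mul0r.
Qed.
Fact fps_mulDl : left_distributive fps_mul fps_add.
Proof.
move=> f g h; apply/fpsP=> n /=; rewrite -big_split /=.
by apply: eq_bigr => i _; rewrite mulrDl.
Qed.
Fact fps_1neq0 : fpsC 1 != 0.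
Proof. by apply/eqP=> /fpsP/(_ 0%N)/eqP; rewrite /= oner_eq0. Qed.

HB.instance Definition _ := GRing.Zmodule_isComNzRing.Build {fps R}
  fps_mulA fps_mulC fps_mul1 fps_mulDl fps_1neq0.

Lemma fcoef0 n : fcoef (0 : {fps R}) n = 0. Proof. by []. Qed.
Lemma fcoef1 n : fcoef (1 : {fps R}) n = (n == 0)%:R.
Proof. by rewrite /=; case: eqP. Qed.
Lemma fcoefD f g n : fcoef (f + g) n = fcoef f n + fcoef g n. Proof. by []. Qed.
Lemma fcoefN f n : fcoef (- f) n = - fcoef f n. Proof. by []. Qed.
Lemma fcoefM f g n :
  fcoef (f * g) n = \sum_(i < n.+1) fcoef f i * fcoef g (n - i).
Proof. by []. Qed.

End FpsZmodule.

Section FpsUnitRing.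
Variable R : comUnitRingType.
Implicit Types f g : {fps R}.

Definition fps_unit : {pred {fps R}} := [pred f | fcoef f 0 \is a GRing.unit].

(* the first [n] coefficients of the inverse of [f] *)
Fixpoint fps_inv_coefs f n : seq R :=
  if n isn't m.+1 then [::] else
  let s := fps_inv_coefs f m in
  rcons s ((fcoef f 0)^-1 *
           ((m == 0)%:R - \sum_(i < m) fcoef f (m - i) * s`_i)).

Definition fps_inv f : {fps R} :=
  if f \in fps_unit then Fps (fun n => (fps_inv_coefs f n.+1)`_n) else f.

Let size_inv_coefs f n : size (fps_inv_coefs f n) = n.
Proof. by elim: n => //= n IHn; rewrite size_rcons IHn. Qed.

Let nth_inv_coefs f n i : (i < n)%N ->
  (fps_inv_coefs f n)`_i = (fps_inv_coefs f i.+1)`_i.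
Proof.
elim: n => // n IHn; rewrite ltnS leq_eqVlt => /predU1P[-> // | lt_in].
by rewrite [LHS]/= nth_rcons size_inv_coefs lt_in IHn.
Qed.

Fact fps_mulVr : {in fps_unit, left_inverse 1 fps_inv *%R}.
Proof.
move=> f Uf; apply/fpsP=> n; rewrite fcoef1 mulrC fcoefM.
rewrite (reindex_inj rev_ord_inj) /=.
transitivity (\sum_(i < n.+1) fcoef f (n - i) * fcoef (fps_inv f) i).
  by apply: eq_bigr => i _; rewrite subSS subKn // -ltnS.
rewrite /fps_inv Uf big_ord_recr /= subnn nth_rcons size_inv_coefs ltnn eqxx.
rewrite mulVKr // addrC -[RHS](subrK (\sum_(i < n) fcoef f (n - i) *
  (fps_inv_coefs f n)`_i)); congr (_ + _); apply: eq_bigr => i _.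
by rewrite (@nth_inv_coefs f n).
Qed.

Fact fps_unitPl f g : g * f = 1 -> f \in fps_unit.
Proof.
move/fpsP/(_ 0%N); rewrite fcoefM big_ord1 subnn fcoef1 => gf.
by apply/unitrPr; exists (fcoef g 0); rewrite mulrC.
Qed.

Fact fps_invr_out : {in [predC fps_unit], fps_inv =1 id}.
Proof. by move=> f; rewrite inE /= /fps_inv => /negbTE ->. Qed.

HB.instance Definition _ := GRing.ComNzRing_hasMulInverse.Build {fps R}
  fps_mulVr fps_unitPl fps_invr_out.

Lemma fps_unitE f : (f \is a GRing.unit) = (fcoef f 0 \is a GRing.unit).
Proof. by []. Qed.

End FpsUnitRing.

(* The identity is read in Q(s, q, Y)[[t]][[u]]: t and u are formal variables and
   s, q, Y lie in the coefficient field, so that 1 - q s is invertible. *)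
Notation coefField := {fraction {mpoly int[3]}}.
Notation series := {fps {fps coefField}}.

Definition constS (c : coefField) : series := fpsC (fpsC c).
Definition sS : series := constS (tofrac 'X_(inord 0)).
Definition qS : series := constS (tofrac 'X_(inord 1)).
Definition YS : series := constS (tofrac 'X_(inord 2)).
Definition tS : series := fpsC (fpsX coefField).
Definition uS : series := fpsX {fps coefField}.

(* coefficient of u^i t^j *)
Definition coefS (f : series) (i j : nat) : coefField := fcoef (fcoef f i) j.

(* [\sum_(r >= 0) F r = S]: every coefficient of the partial sums is eventually
   equal to the one of S. *)
Definition sums_to (F : nat -> series) (S : series) : Prop :=
  forall i j, exists N, forall M, (N <= M)%N ->
    coefS (\sum_(r < M) F r) i j = coefS S i j.

Definition qpoch (R : nzRingType) (a q : R) (n : nat) : R :=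
  \prod_(i < n) (1 - a * q ^+ i).

(* Polynomials in s, t, q, Y are elements of {mpoly int[4]}, in this order. *)
Definition ps : {mpoly int[4]} := 'X_(inord 0).
Definition pt : {mpoly int[4]} := 'X_(inord 1).
Definition pq : {mpoly int[4]} := 'X_(inord 2).
Definition pY : {mpoly int[4]} := 'X_(inord 3).

Definition series_of_poly (P : {mpoly int[4]}) : series :=
  mmap intr (tnth [tuple sS; tS; qS; YS]) P.

Definition lhs_term (r : nat) : series :=
  tS ^+ r *
  (((1 - qS * sS) * qpoch uS qS r * qpoch (uS * sS * qS) qS r)
   / ((qpoch uS qS r - sS * qS * qpoch (uS * sS * qS) qS r)
      * qpoch (uS * YS) qS r.+1)).

(* Division in [series] is only meaningful by a unit; all the denominators of
   [lhs_term] and [rhs_term] are units. *)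
Section Denominators.
Let c0 (f : series) := coefS f 0 0.
Let c0D f g : c0 (f + g) = c0 f + c0 g. Proof. by []. Qed.
Let c0N f : c0 (- f) = - c0 f. Proof. by []. Qed.
Let c0M f g : c0 (f * g) = c0 f * c0 g.
Proof. by rewrite /c0 /coefS !(fcoefM, big_ord1). Qed.
Let c0C c : c0 (constS c) = c. Proof. by []. Qed.
Let c0u : c0 uS = 0. Proof. by []. Qed.
Let c01 : c0 1 = 1. Proof. by []. Qed.
Let c0_qpoch a q n : c0 a = 0 -> c0 (qpoch a q n) = 1.
Proof.
move=> a0; rewrite /qpoch; elim/big_ind: _ => // [f g f1 g1|i _].
  by rewrite c0M f1 g1 mulr1.
by rewrite c0D c01 c0N c0M a0 mul0r subr0.
Qed.
Let c0_unit f : (f \is a GRing.unit) = (c0 f != 0).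
Proof. by rewrite !fps_unitE unitfE. Qed.

Let den_unit (a b c d : series) : c0 a = 1 -> c0 b = 1 -> c0 c = 1 ->
  c0 d != 1 -> (a - d * b) * c \is a GRing.unit.
Proof.
move=> a1 b1 c1 d1; rewrite c0_unit c0M c0D c0N c0M a1 b1 c1 !mulr1.
by rewrite subr_eq0 eq_sym.
Qed.

Lemma lhs_den_unit r :
  (qpoch uS qS r - sS * qS * qpoch (uS * sS * qS) qS r)
    * qpoch (uS * YS) qS r.+1 \is a GRing.unit.
Proof.
have cu c : c0 (uS * c) = 0 by rewrite c0M [c0 uS]c0u mul0r.
apply: den_unit; [exact/c0_qpoch/c0u| |exact/c0_qpoch/cu|].
  by apply: c0_qpoch; rewrite -mulrA; apply: cu.
have -> : c0 (sS * qS) = tofrac ('X_(inord 0) * 'X_(inord 1)).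
  by rewrite c0M tofracM; congr (_ * _); exact: c0C.
rewrite -tofrac1 tofrac_eq -mpolyXD -mpolyX0.
apply/eqP=> /mpolyP/(_ 0%MM)/eqP; rewrite !mcoeffX eqxx.
by rewrite -mdeg_eq0 mdegD !mdeg1.
Qed.

Lemma rhs_den_unit n : qpoch tS qS n \is a GRing.unit.
Proof. by rewrite c0_unit c0_qpoch ?oner_eq0. Qed.
End Denominators.

Definition rhs_term (A : nat -> {mpoly int[4]}) (n : nat) : series :=
  series_of_poly (A n) * (uS ^+ n / qpoch tS qS n.+1).

Definition generating_identity (A : nat -> {mpoly int[4]}) : Prop :=
  exists S : series, sums_to lhs_term S /\ sums_to (rhs_term A) S.

(* Main.v *)
From HB Require Import structures.
Require Import Defs.
From mathcomp Require Import all_boot all_order all_fingroup all_algebra.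
From mathcomp Require Import mpoly ring zify.
From mathcomp Require boolp.

(* By MacMahon's Verfahren, a word [w] of length [n] with letters at most [r] has a
   unique standardization [sigma], obtained by numbering its positions by decreasing
   letters and, among equal letters, from left to right. Weighting words by
   [q ^ (sum of letters)], the words with standardization [sigma] have generating
   function in [t ^ r] equal to [t^ides q^imaj / (t;q)_(n+1)], while [pix] and [lec]
   of [sigma] can be read on [w], increasing becoming weakly decreasing. It remains
   to sum over all words with letters at most [r]: by the hook factorization this is
   [1 / ((uY;q)_(r+1) (1 - h))], where [h] enumerates the hooks
   [x1 < x2 >= x3 >= ...]. The sum over the first letter [x1] telescopes to
   [(1 - sq)(1 - h) = 1 / (usq;q)_r - sq / (u;q)_r]. *)

Set Implicit Arguments.
Unset Strict Implicit.
Unset Printing Implicit Defensive.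

Import GRing.Theory.

(** * Hook factorizations read on words *)

Section PixLec.
Local Open Scope nat_scope.

(* The pair ([pix], [lec]) of [w], where [e x y] says that [x], standing to the left
   of [y], counts as smaller than [y]: [e] is [ltn] for permutations, and [geq] for
   the words that standardize to them. *)
Fixpoint pixlec T (e : rel T) (w : seq T) : nat * nat :=
  if w is x :: w' then
    let: (k, l) := pixlec e w' in
    if path e x (take k w') then (k.+1, l)
    else (0, l + count (fun y => ~~ e x y) (take k w'))
  else (0, 0).

Lemma pixlec_cons T (e : rel T) x w : pixlec e (x :: w) =
  if path e x (take (pixlec e w).1 w) then ((pixlec e w).1.+1, (pixlec e w).2)
  else (0, (pixlec e w).2 + count (fun y => ~~ e x y) (take (pixlec e w).1 w)).
Proof. by rewrite /=; case: pixlec. Qed.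

Lemma pix_le_size T (e : rel T) w : (pixlec e w).1 <= size w.
Proof. by elim: w => //= x w; case: pixlec => k l /=; case: ifP. Qed.

Lemma pixlec_map T U (e : rel T) (f : U -> T) w :
  pixlec e (map f w) = pixlec (relpre f e) w.
Proof.
elim: w => // x w IHw; rewrite /= IHw; case: pixlec => k l.
by rewrite -map_take path_map count_map.
Qed.

(** [pixlec] only compares a letter with letters to its right. This is how [pix] and [lec] pass from
    a permutation to the words it standardizes. *)
Lemma eq_pixlec T (e1 e2 : rel T) w :
  pairwise (fun x y => e1 x y == e2 x y) w -> pixlec e1 w = pixlec e2 w.
Proof.
elim: w => // x w IHw /=/andP[exw ew]; rewrite IHw //.
case: pixlec => k l.
have: all (fun y => e1 x y == e2 x y) (take k w).
  by move: exw; rewrite -{1}(cat_take_drop k w) all_cat => /andP[].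
have: pairwise (fun x y => e1 x y == e2 x y) (take k w).
  by move: ew; rewrite -{1}(cat_take_drop k w) pairwise_cat => /and3P[].
move: (take k w) => v ev exv.
have -> : count (fun y => ~~ e1 x y) v = count (fun y => ~~ e2 x y) v.
  by elim: v exv {ev} => //= y v IHv /andP[/eqP-> /IHv->].
suff -> : path e1 x v = path e2 x v by [].
elim: v x exv ev {exw} => //= y v IHv x /andP[/eqP-> _] /andP[eyv ev].
by rewrite IHv.
Qed.

Lemma pixlec_cat T (e : rel T) p v : sorted e p -> (pixlec e v).1 = 0 ->
  pixlec e (p ++ v) = (size p, (pixlec e v).2).
Proof.
move=> sp v0; elim: p sp => [|x p IHp] /= sp; first by case: pixlec v0 => k l /= ->.
by rewrite IHp ?(path_sorted sp) // take_size_cat // sp.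
Qed.

Lemma pix_cat_size T (e : rel T) p v :
  ((pixlec e (p ++ v)).1 == size p) = sorted e p && ((pixlec e v).1 == 0).
Proof.
apply/eqP/andP => [|[sp /eqP v0]]; last by rewrite pixlec_cat.
elim: p => [|x p IHp]; first by move/eqP.
rewrite cat_cons pixlec_cons; case: ifP => // pth [ek].
have [_ v0] := IHp ek.
by split=> //; rewrite ek take_size_cat // in pth.
Qed.

Lemma invw_cons x p : invw (x :: p) = count (fun y => y < x) p + invw p.
Proof.
rewrite /invw /= big_ord_recl /=; congr (_ + _).
  rewrite big_mkcond big_ord_recl /= add0n.
  rewrite -sum1_count (big_nth 0) big_mkord [RHS]big_mkcond /=.
  by apply: eq_bigr => i _.
by apply: eq_bigr => a _; rewrite big_mkcond big_ord_recl /= add0n [RHS]big_mkcond.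
Qed.

Lemma invw_increasing p : increasing p -> invw p = 0.
Proof.
elim: p => [|x p IHp] sp; first by rewrite /invw big_ord0.
rewrite invw_cons IHp; last exact: path_sorted sp.
rewrite addn0; apply/eqP.
rewrite eqn0Ngt -has_count -all_predC.
have /allP lt_x := order_path_min ltn_trans sp.
by apply/allP=> y /lt_x /= /ltnW; rewrite -leqNgt.
Qed.

(** Read from right to left, a new letter either extends the increasing prefix or stands in front of
    it to form a hook, which leaves an empty prefix. *)
Lemma hook_factorization_pixlec w : uniq w && all (ltn 0) w ->
  exists2 ph, hook_factorization w ph &
    pixlec ltn w = (size ph.1, \sum_(h <- ph.2) invw h).
Proof.
elim: w => [_|x w IHw]; first by exists ([::], [::]); rewrite ?big_nil.
move=> /andP[/= /andP[xw uw] /andP[x0 w0]].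
have [|[p hs]] := IHw; first by rewrite uw.
rewrite /hook_factorization /= => /and3P[/eqP def_w sp hhs] ->.
have -> : take (size p) w = p by rewrite def_w take_size_cat.
case: ifP => [xp | nxp].
  by exists (x :: p, hs); rewrite //= def_w eqxx xp.
have uxp : uniq (x :: p).
  by move: xw uw; rewrite /= def_w cat_uniq mem_cat negb_or => /andP[-> _] /andP[].
have p0 : all (ltn 0) (x :: p).
  by move: w0; rewrite /= x0 def_w all_cat => /andP[].
exists ([::], (x :: p) :: hs) => /=.
  rewrite def_w eqxx hhs andbT -/(is_hook (x :: p)).
  (* The prefix is nonempty, since [path] holds on an empty one, and distinctness of letters rules
     out [x = y]. *)
  case: p sp nxp uxp p0 {def_w} => [|y p] sp // nxp uxp p0.
  rewrite /is_hook uxp p0 sp andbT /=.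
  move: nxp uxp; rewrite /= in_cons !negb_or.
  by rewrite (sp : path ltn y p) andbT => /negbT; case: ltngtP.
(* The tail of the hook increases, so every inversion involves [x]; as [x] is not in [p], not
   smaller means larger. *)
rewrite big_cons addnC invw_cons (invw_increasing sp) addn0; congr (_, _ + _).
apply: eq_in_count => y yp; rewrite -leqNgt leq_eqVlt.
by case: eqP uxp => // <-; rewrite /= yp.
Qed.

Lemma pixlec_perm n (sigma : 'S_n) :
  pixlec ltn (perm_word sigma) = (pix sigma, lec sigma).
Proof.
have [ph hph ->] := hook_factorization_pixlec (perm_word_ok sigma).
have := xchooseP (hook_factorization_exists (perm_word_ok sigma)).
by move/(hook_factorization_unique hph) => e; rewrite /pix /lec /hookfact -e.
Qed.

End PixLec.
Arguments pixlec : simpl never.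

(** * Sums over words with letters at most [r] *)

Section Words.
Variable r : nat.

Fixpoint words n : seq (seq nat) :=
  if n is n'.+1 then [seq a :: w | a <- iota 0 r.+1, w <- words n'] else [:: [::]].

Lemma mem_words n w : (w \in words n) = (size w == n) && all (fun a => a <= r)%N w.
Proof.
elim: n w => [|n IHn] w; first by case: w => [|a w].
have in_iota a : (a \in iota 0 r.+1) = (a <= r)%N by rewrite mem_iota ltnS.
apply/allpairsP/idP => [[[b v] [hb hv ->]]|].
  by move: hb hv; rewrite in_iota IHn => /= -> /andP[/eqP-> ->]; rewrite eqxx.
case: w => [|a w]; rewrite ?andbF //= eqSS => /and3P[hs ha hw].
by exists (a, w); split; rewrite ?in_iota ?IHn ?hs.
Qed.

Lemma uniq_words n : uniq (words n).
Proof.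
elim: n => // n IHn; apply: allpairs_uniq (iota_uniq _ _) IHn _.
by move=> [a v] [b w] _ _ /= [-> ->].
Qed.

Local Open Scope ring_scope.
Variable R : nmodType.

Lemma sum_words_cons n (P : pred (seq nat)) (F : seq nat -> R) :
  \sum_(w <- words n.+1 | P w) F w =
  \sum_(a < r.+1) \sum_(w <- words n | P (nat_of_ord a :: w)) F (nat_of_ord a :: w).
Proof.
rewrite big_mkcond [LHS]big_allpairs_dep -[RHS](big_mkord xpredT (fun a =>
  \sum_(w <- words n | P (a :: w)) F (a :: w))).
by apply: eq_bigr => a _; rewrite [RHS]big_mkcond.
Qed.

Lemma sum_words_cat k m (P : pred (seq nat)) (F : seq nat -> R) :
  \sum_(w <- words (k + m) | P w) F w =
  \sum_(p <- words k) \sum_(v <- words m | P (p ++ v)) F (p ++ v).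
Proof.
elim: k P F => [|k IHk] P F; first by rewrite big_seq1.
rewrite addSn !sum_words_cons; apply: eq_bigr => a _.
by rewrite (IHk (fun w => P (nat_of_ord a :: w)) (fun w => F (nat_of_ord a :: w))).
Qed.

End Words.
Arguments words : simpl never.

Local Open Scope ring_scope.

(** * The generating function of words *)

Section FpsC.
Variable R : comNzRingType.

Lemma fpsC_is_zmod_morphism : zmod_morphism (@fpsC R).
Proof. by move=> a b; apply/fpsP=> -[|n] //=; rewrite subr0. Qed.

Lemma fpsC_is_monoid_morphism : monoid_morphism (@fpsC R).
Proof.
split=> // a b; apply/fpsP=> -[|n] /=; first by rewrite big_ord1.
by rewrite big1 // => -[[|i] lt_i] _ /=; rewrite ?mulr0 ?mul0r.
Qed.

HB.instance Definition _ :=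
  GRing.isZmodMorphism.Build R {fps R} (@fpsC R) fpsC_is_zmod_morphism.
HB.instance Definition _ :=
  GRing.isMonoidMorphism.Build R {fps R} (@fpsC R) fpsC_is_monoid_morphism.

Lemma fcoefCM c (f : {fps R}) n : fcoef (fpsC c * f) n = c * fcoef f n.
Proof.
rewrite fcoefM big_ord_recl /= subn0 big1 ?addr0 // => i _.
by rewrite mul0r.
Qed.

Lemma fcoefXM (f : {fps R}) n :
  fcoef (fpsX R * f) n = if n is m.+1 then fcoef f m else 0.
Proof.
rewrite fcoefM; case: n => [|n]; first by rewrite big_ord1 mul0r.
rewrite 2!big_ord_recl /= mul0r add0r mul1r subSS subn0 big1 ?addr0 // => i _.
by rewrite mul0r.
Qed.

Lemma fcoefXnM (f : {fps R}) m n :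
  fcoef (fpsX R ^+ m * f) n = if (m <= n)%N then fcoef f (n - m) else 0.
Proof.
elim: m n => [|m IHm] n; first by rewrite mul1r subn0.
by rewrite exprS -mulrA fcoefXM; case: n => // n; rewrite IHm.
Qed.

Lemma fcoef_sum (I : Type) (r : seq I) (P : pred I) (F : I -> {fps R}) n :
  fcoef (\sum_(i <- r | P i) F i) n = \sum_(i <- r | P i) fcoef (F i) n.
Proof. exact: (big_morph (fun f : {fps R} => fcoef f n)). Qed.

End FpsC.

(** Every word is cut at its [pix], the only length [k] for which the prefix is weakly decreasing
    and the rest is a sequence of hooks. *)
Lemma sum_words_pix (R : nmodType) r n (F : seq nat -> R) :
  \sum_(w <- words r n) F w =
  \sum_(k < n.+1) \sum_(p <- words r k | sorted geq p)
    \sum_(v <- words r (n - k) | (pixlec geq v).1 == 0%N) F (p ++ v).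
Proof.
transitivity (\sum_(w <- words r n) \sum_(k < n.+1 | k == (pixlec geq w).1 :> nat) F w).
  apply: eq_big_seq => w; rewrite mem_words => /andP[/eqP sw _].
  rewrite (big_ord1_eq _ (fun=> F w)) ltnS -sw.
  by have /= -> := pix_le_size geq w.
rewrite (exchange_big_dep xpredT) //=; apply: eq_bigr => k _.
have kn : (k <= n)%N by rewrite -ltnS.
rewrite -{1}(subnKC kn) sum_words_cat [RHS]big_mkcond.
apply: eq_big_seq => p; rewrite mem_words => /andP[/eqP sp _].
rewrite -sp [LHS](eq_bigl (fun v => sorted geq p && ((pixlec geq v).1 == 0%N))).
  by case: ifP => _ //; rewrite big_pred0.
by move=> v; rewrite eq_sym pix_cat_size.
Qed.

(* The complete homogeneous symmetric polynomial of degree [k] in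
   [c 0, ..., c m.-1], by recursion on the largest index. *)
Fixpoint complete_sym (R : pzSemiRingType) (c : nat -> R) m k : R :=
  if k is k'.+1 then \sum_(a < m) c a * complete_sym c a.+1 k' else 1.

(** A weakly decreasing word is a multiset of letters, hence a monomial of the complete symmetric
    polynomial. The starting point [m] of the path bounds the first letter, as the induction
    requires. *)
Lemma sum_words_path (R : comPzSemiRingType) (c : nat -> R) r m k : (m <= r)%N ->
  \sum_(p <- words r k | path geq m p) \prod_(a <- p) c a = complete_sym c m.+1 k.
Proof.
elim: k m => [|k IHk] m le_mr; first by rewrite big_mkcond big_seq1 big_nil.
rewrite sum_words_cons /=.
transitivity (\sum_(a < r.+1 | (a < m.+1)%N)
  \sum_(w <- words r k | path geq a w) \prod_(b <- (a : nat) :: w) c b).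
  rewrite [RHS]big_mkcond /=; apply: eq_bigr => a _; rewrite ltnS.
  by case: ifP => _ //=; rewrite big_pred0.
rewrite -(big_ord_widen r.+1 (fun a => \sum_(w <- words r k | path geq a w)
  \prod_(b <- a :: w) c b)) //.
apply: eq_bigr => a _.
under eq_bigr do rewrite big_cons.
by rewrite -mulr_sumr IHk // (leq_trans _ le_mr) // -ltnS.
Qed.

(** * The generating function of complete symmetric polynomials *)

Section CompleteSymGF.
Variable R : comNzRingType.
Implicit Type c : nat -> R.

Definition complete_gf c m : {fps R} := Fps (complete_sym c m).

Lemma complete_gf0 c : complete_gf c 0 = 1.
Proof. by apply/fpsP=> -[|k] //=; rewrite big_ord0. Qed.

Lemma complete_gfS c m :
  (1 - fpsX R * fpsC (c m)) * complete_gf c m.+1 = complete_gf c m.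
Proof.
apply/fpsP=> k; rewrite mulrBl mul1r -mulrA fcoefD fcoefN fcoefXM.
case: k => [|k]; first by rewrite subr0.
by rewrite fcoefCM /= big_ord_recr addrK.
Qed.

Lemma complete_gfK c m :
  (\prod_(a < m) (1 - fpsX R * fpsC (c a))) * complete_gf c m = 1.
Proof.
elim: m => [|m IHm]; first by rewrite big_ord0 mul1r complete_gf0.
by rewrite big_ord_recr -mulrA complete_gfS.
Qed.

End CompleteSymGF.

Section WordsGF.
Variables (R : comNzRingType) (s q Y : R) (r : nat).

Definition word_weight w : R :=
  s ^+ (pixlec geq w).2 * q ^+ sumn w * Y ^+ (pixlec geq w).1.

Definition wordsGF : {fps R} :=
  Fps (fun n => \sum_(w <- words r n) word_weight w).

(* [V] enumerates the words with [pix = 0], i.e., the sequences of hooks, and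
   [fpsX * H] the hooks; [x] is the first letter of the hook. *)
Let V : {fps R} :=
  Fps (fun n => \sum_(w <- words r n | (pixlec geq w).1 == 0%N)
    s ^+ (pixlec geq w).2 * q ^+ sumn w).

Let H : {fps R} :=
  Fps (fun k => \sum_(x < r.+1) \sum_(p <- words r k | sorted geq p && (x < head 0 p)%N)
    s ^+ count (ltn x) p * q ^+ (x + sumn p)).

Let sorted_path w : all (fun a => a <= r)%N w -> sorted geq w = path geq r w.
Proof. by case: w => //= a w /andP[-> _]. Qed.

Let wordsGF_V : wordsGF = complete_gf (fun b => Y * q ^+ b) r.+1 * V.
Proof.
apply/fpsP=> n; rewrite fcoefM [LHS]sum_words_pix; apply: eq_bigr => k _ /=.
rewrite -(@sum_words_path _ _ r) // mulr_suml.
rewrite big_seq_cond [RHS]big_seq_cond.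
apply: eq_big => [p|p /andP[]].
  by rewrite mem_words; case al: (all _ p); rewrite ?andbF // (sorted_path al).
rewrite mem_words => /andP[/eqP sp _] srt.
rewrite mulr_sumr; apply: eq_bigr => v /eqP v0.
rewrite /word_weight pixlec_cat // sumn_cat exprD /=.
have -> : \prod_(b <- p) (Y * q ^+ b) = Y ^+ size p * q ^+ sumn p.
  elim: (p) => [|a p' IHp]; first by rewrite big_nil mul1r.
  by rewrite big_cons IHp /= exprS exprD; ring.
by ring.
Qed.

(** A nonempty sequence of hooks starts with a letter [x]; the prefix of what follows is the tail of
    the first hook, and the rest is again a sequence of hooks. *)
Let V_H : V = 1 + fpsX R * H * V.
Proof.
apply/fpsP=> -[|n].
  rewrite fcoefD -mulrA fcoefXM addr0 /= big_mkcond big_seq1 /=.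
  by rewrite mulr1.
rewrite fcoefD fcoef1 add0r -mulrA fcoefXM fcoefM [LHS]sum_words_cons.
under eq_bigr do rewrite big_mkcond sum_words_pix.
rewrite exchange_big; apply: eq_bigr => k _ /=.
rewrite mulr_suml; apply: eq_bigr => x _ /=.
rewrite mulr_suml big_mkcond [RHS]big_mkcond /=.
apply: eq_big_seq => p; rewrite mem_words => /andP[/eqP sp _].
case srt: (sorted geq p) => //=.
transitivity (\sum_(v <- words r (n - k) | (pixlec geq v).1 == 0%N)
  if (x < head 0 p)%N then s ^+ (count (ltn x) p + (pixlec geq v).2) *
        q ^+ (x + sumn p + sumn v) else 0).
  apply: eq_bigr => v /eqP v0.
  have := pixlec_cons geq x (p ++ v).
  rewrite pixlec_cat // take_size_cat // => ->.
  (* The default value 0 makes this hold for empty [p] too. *)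
  have -> : path geq x p = ~~ (x < head 0 p)%N.
    by case: (p) srt => //= a p' ->; rewrite andbT -leqNgt.
  case: ltnP => //= _; rewrite addnC sumn_cat addnA.
  by congr (s ^+ (_ + _) * _); apply: eq_count => y; rewrite /= -ltnNge.
case: ifP => _; last by rewrite big1.
by rewrite mulr_sumr; apply: eq_bigr => v _; rewrite !exprD; ring.
Qed.

(** Tails whose first letter exceeds [x] are all weakly decreasing words minus those with letters at
    most [x]. The exponent [(x < b)] spreads the count of letters above [x] over the letters; it
    vanishes on the subtracted words. *)
Let H_complete : H = \sum_(x < r.+1) fpsC (q ^+ x) *
  (complete_gf (fun b => s ^+ (x < b)%N * q ^+ b) r.+1
   - complete_gf (fun b => q ^+ b) x.+1).
Proof.
apply/fpsP=> k; rewrite fcoef_sum [LHS]/=; apply: eq_bigr => x _.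
rewrite fcoefCM fcoefD fcoefN /=.
rewrite -(@sum_words_path _ (fun b => s ^+ (x < b)%N * q ^+ b) r r) //.
have le_xr : (x <= r)%N by rewrite -ltnS.
rewrite -(@sum_words_path _ (fun b => q ^+ b) r x) //.
have prodE p : \prod_(b <- p) (s ^+ (x < b)%N * q ^+ b) = s ^+ count (ltn x) p * q ^+ sumn p.
  elim: p => [|a p IHp]; first by rewrite big_nil mul1r.
  by rewrite big_cons IHp /= !exprD; ring.
have prodE' p : \prod_(b <- p) q ^+ b = q ^+ sumn p.
  by elim: p => [|a p IHp]; rewrite ?big_nil // big_cons IHp /= exprD.
under [X in _ = _ * (X - _)]eq_bigr do rewrite prodE.
under [X in _ = _ * (_ - X)]eq_bigr do rewrite prodE'.
apply/eqP; rewrite mulrBr eq_sym subr_eq !mulr_sumr; apply/eqP.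
rewrite big_mkcond [X in _ = X + _]big_mkcond [X in _ = _ + X]big_mkcond -big_split /=; apply: eq_big_seq => p.
rewrite mem_words => /andP[_ /sorted_path pr]; rewrite -pr.
have -> : path geq x p = sorted geq p && ~~ (x < head 0 p)%N.
  by case: (p) => //= a p'; rewrite -leqNgt andbC.
case srt: (sorted geq p) => //=; last by rewrite addr0.
case: ltnP => /= xp; first by rewrite addr0 exprD; ring.
rewrite add0r; congr (_ * _); suff -> : count (ltn x) p = 0%N by rewrite mul1r.
apply/eqP; rewrite eqn0Ngt -has_count -all_predC.
have: path geq x p by case: (p) srt xp => //= a p' -> ->.
move/(order_path_min (rev_trans leq_trans)) => /allP le_x.
by apply/allP=> y /le_x /=; rewrite -leqNgt.
Qed.

Local Notation u := (fpsX R).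
Local Notation qC := (fpsC q).
Local Notation sC := (fpsC s).
Local Notation YC := (fpsC Y).

Let qpoch_complete (a : R) m :
  qpoch (u * fpsC a) qC m * complete_gf (fun b => a * q ^+ b) m = 1.
Proof.
rewrite -[RHS](complete_gfK (fun b => a * q ^+ b) m); congr (_ * _).
by apply: eq_bigr => b _; rewrite rmorphM rmorphXn mulrA.
Qed.

Let qpochS (a : {fps R}) m : qpoch a qC m.+1 = qpoch a qC m * (1 - a * qC ^+ m).
Proof. by rewrite /qpoch big_ord_recr. Qed.

(** The inverses of [D] and [E] are carried as the explicit series [d] and [e], so that no division
    occurs over the ring [R]. *)
Let D m := qpoch u qC m.
Let E m := qpoch (u * sC * qC) qC m.
Let d m := complete_gf (fun b => q ^+ b) m.
Let e m := complete_gf (fun b => s * q * q ^+ b) m.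

Let Dd m : D m * d m = 1.
Proof.
have := qpoch_complete 1 m; rewrite rmorph1 mulr1 => <-; congr (_ * _).
by congr complete_gf; apply/boolp.funext => b; rewrite mul1r.
Qed.

Let Ee m : E m * e m = 1.
Proof. by have := qpoch_complete (s * q) m; rewrite rmorphM mulrA. Qed.

(** The factors with [b <= x] form [D x.+1], and those with [b > x] form [E r] divided by [E x]. *)
Let complete_hook x : (x <= r)%N ->
  complete_gf (fun b => s ^+ (x < b)%N * q ^+ b) r.+1 = E x * d x.+1 * e r.
Proof.
move=> le_xr; set g := complete_gf _ _.
pose f b : {fps R} := 1 - u * fpsC (s ^+ (x < b)%N * q ^+ b).
have prodE m : (x <= m)%N -> E x * \prod_(b < m.+1) f b = D x.+1 * E m.
  elim: m => [|m IHm]; first rewrite leqn0 => /eqP->.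
    by rewrite /E /D /qpoch !big_ord0 !big_ord1 /f /= !expr0 mulr1 rmorph1 !mulr1 mul1r.
  rewrite leq_eqVlt => /predU1P[<-|lt_xm].
    rewrite mulrC; congr (_ * _); apply: eq_bigr => b _; rewrite /f.
    by rewrite ltnNge -ltnS ltn_ord mul1r rmorphXn.
  rewrite big_ord_recr mulrA IHm // /E qpochS -mulrA; congr (_ * (_ * _)).
  by rewrite /f lt_xm /= expr1 rmorphM rmorphXn /= exprS; ring.
have gK : \prod_(b < r.+1) f b * g = 1 by apply: complete_gfK.
have := prodE r le_xr; move: (\prod_(b < _) _) gK => p pg Ep.
transitivity (g * (D x.+1 * d x.+1) * (E r * e r)).
  by rewrite Dd Ee !mulr1.
transitivity (g * (D x.+1 * E r) * d x.+1 * e r); first by ring.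
by rewrite -Ep -[E x in RHS]mulr1 -pg; ring.
Qed.

(* Both sums telescope, since [u q^x d_(x+1) = d_(x+1) - d_x] and
   [(1 - sq) u q^x E_x d_(x+1) = E_(x+1) d_(x+1) - E_x d_x]. *)
Let H_closed : (1 - qC * sC) * (1 - u * H) = e r - sC * qC * d r.
Proof.
have dS m : (1 - u * qC ^+ m) * d m.+1 = d m.
  by rewrite -rmorphXn; apply: complete_gfS.
have uH : u * H = \sum_(x < r.+1) u * qC ^+ x * (E x * d x.+1 * e r - d x.+1).
  rewrite H_complete mulr_sumr; apply: eq_bigr => x _.
  have le_xr : (x <= r)%N by rewrite -ltnS.
  by rewrite complete_hook // rmorphXn mulrA.
have tel m : (1 - qC * sC) * (\sum_(x < m) u * qC ^+ x * (E x * d x.+1 * e r - d x.+1))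
  = (E m * d m - 1) * e r - (1 - qC * sC) * (d m - 1).
  elim: m => [|m IHm].
    by rewrite big_ord0 /E /qpoch big_ord0 /d complete_gf0; ring.
  rewrite big_ord_recr mulrDr IHm /E qpochS -/(E m) -(dS m); ring.
rewrite uH mulrBr tel /E qpochS -/(E r).
(* In the boundary term [E r.+1 * d r.+1 * e r], [E r] cancels [e r]; the remaining multiples of
   [d r.+1] combine through [dS]. *)
transitivity ((1 - qC * sC) * d r.+1 + e r
   - (1 - u * sC * qC * qC ^+ r) * d r.+1 * (E r * e r)); first by ring.
by rewrite Ee -(dS r); ring.
Qed.

(** [wordsGF] is the product of the inverse of [(uY;q)_(r+1)] and [V], the inverse of [1 - u * H];
    multiplying [H_closed] by [D r * E r] produces the other denominator. *)
Lemma wordsGFE :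
  wordsGF * ((qpoch u qC r - sC * qC * qpoch (u * sC * qC) qC r)
    * qpoch (u * YC) qC r.+1)
  = (1 - qC * sC) * qpoch u qC r * qpoch (u * sC * qC) qC r.
Proof.
rewrite -/(D r) -/(E r) wordsGF_V; set c := complete_gf _ _.
have cY : qpoch (u * YC) qC r.+1 * c = 1 by apply: qpoch_complete.
have VH : (1 - u * H) * V = 1 by rewrite mulrBl mul1r {1}V_H addrK.
have -> : D r - sC * qC * E r = (1 - qC * sC) * (1 - u * H) * D r * E r.
  rewrite H_closed; transitivity (D r * (E r * e r) - sC * qC * E r * (D r * d r)).
    by rewrite Dd Ee !mulr1.
  by ring.
transitivity ((1 - qC * sC) * D r * E r * ((1 - u * H) * V) *
  (qpoch (u * YC) qC r.+1 * c)); first by ring.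
by rewrite VH cY !mulr1.
Qed.

End WordsGF.

(** * MacMahon's Verfahren *)

Section QScale.
Variables (R : comNzRingType) (q : R).

(* The substitution [t -> q t] in a power series in [t]. *)
Definition qscale (f : {fps R}) : {fps R} := Fps (fun n => q ^+ n * fcoef f n).

Lemma qscale_is_zmod_morphism : zmod_morphism qscale.
Proof. by move=> f g; apply/fpsP=> n /=; rewrite mulrBr. Qed.

Lemma qscale_is_monoid_morphism : monoid_morphism qscale.
Proof.
split=> [|f g]; apply/fpsP=> n /=; first by case: n => [|n]; rewrite ?mulr1 ?mulr0.
rewrite mulr_sumr; apply: eq_bigr => i _.
have le_in : (i <= n)%N by rewrite -ltnS.
by rewrite -{1}(subnKC le_in) exprD; ring.
Qed.

HB.instance Definition _ :=
  GRing.isZmodMorphism.Build {fps R} {fps R} qscale qscale_is_zmod_morphism.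
HB.instance Definition _ :=
  GRing.isMonoidMorphism.Build {fps R} {fps R} qscale qscale_is_monoid_morphism.

Lemma qscaleX : qscale (fpsX R) = fpsX R * fpsC q.
Proof.
apply/fpsP=> n; rewrite fcoefXM /=.
by case: n => [|[|n]]; rewrite /= ?mulr0 // mulr1.
Qed.

Lemma qscaleC c : qscale (fpsC c) = fpsC c.
Proof. by apply/fpsP=> -[|n] /=; rewrite ?mul1r ?mulr0. Qed.

Lemma qscale_qpoch m :
  (1 - fpsX R) * qscale (qpoch (fpsX R) (fpsC q) m) = qpoch (fpsX R) (fpsC q) m.+1.
Proof.
rewrite /qpoch big_ord_recl expr0 mulr1 rmorph_prod; congr (_ * _).
apply: eq_bigr => i _.
by rewrite rmorphB rmorph1 rmorphM rmorphXn /= qscaleX qscaleC exprS mulrA.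
Qed.

End QScale.

(** * Bounded decreasing sequences with prescribed strict steps *)

Section Chains.
Variables (R : comNzRingType) (q : R).

(* [w] is a sequence [w_1, w_2, ...] with [x >= w_1 + e_1], [w_1 >= w_2 + e_2], ... *)
Fixpoint chain (x : nat) (es : seq bool) (w : seq nat) : bool :=
  match es, w with
  | e :: es', c :: w' => (c + e <= x)%N && chain c es' w'
  | _, _ => true
  end.

Lemma chainP x es w : size es = size w ->
  reflect (forall i, i < size w -> nth 0 w i + nth false es i <= nth 0 (x :: w) i)%N
    (chain x es w).
Proof.
elim: w x es => [|c w IHw] x [|e es] //=; first by move=> _; constructor.
move=> [sz].
apply: (iffP andP) => [[cx /(IHw _ _ sz) cw] [|i] //= | H]; first exact: cw.
split; first exact: (H 0%N).
by apply/(IHw _ _ sz) => i; apply: (H i.+1).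
Qed.

Fixpoint chain_sum (es : seq bool) (x : nat) : R :=
  if es is e :: es' then \sum_(c < x.+1 | (c + e <= x)%N) q ^+ c * chain_sum es' c
  else 1.

Lemma sum_words_chain r es x : (x <= r)%N ->
  \sum_(w <- words r (size es) | chain x es w) q ^+ sumn w = chain_sum es x.
Proof.
elim: es x => [|e es IHes] x le_xr; first by rewrite big_mkcond big_seq1.
rewrite sum_words_cons /=.
transitivity (\sum_(c < r.+1 | (c < x.+1)%N) if (c + e <= x)%N then
  \sum_(w <- words r (size es) | chain c es w) q ^+ (c + sumn w) else 0).
  rewrite [RHS]big_mkcond; apply: eq_bigr => c _; rewrite ltnS.
  case cx: (c + e <= x)%N => /=; last by rewrite big_pred0 //; case: ifP.
  by rewrite (leq_trans (leq_addr _ _) cx).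
rewrite -(big_ord_widen r.+1 (fun c => if (c + e <= x)%N then
  \sum_(w <- words r (size es) | chain c es w) q ^+ (c + sumn w) else 0)) //.
rewrite [RHS]big_mkcond; apply: eq_bigr => c _; case: ifP => // _.
under eq_bigr do rewrite exprD.
by rewrite -mulr_sumr IHes // (leq_trans _ le_xr) // -ltnS.
Qed.

(* Splitting off the first letter [c] leaves chains bounded by [c] instead of [x],
   which [q ^+ c] turns into the substitution [t -> q t]. *)
Lemma chain_sumS e es :
  (1 - fpsX R) * Fps (chain_sum (e :: es)) = fpsX R ^+ e * qscale q (Fps (chain_sum es)).
Proof.
(* Multiplying by [1 - fpsX R] subtracts consecutive sums and leaves the single term [c + e = n]. *)
apply/fpsP=> n; rewrite mulrBl mul1r fcoefD fcoefN fcoefXM fcoefXnM.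
case: e => /=.
  under eq_bigl do rewrite addn1.
  case: n => [|n]; first by rewrite subr0 big_pred0.
  rewrite subSS subn0 big_mkcond big_ord_recr /= ltnn addr0.
  rewrite big_ord_recr /= ltnSn addrC.
  under [X in _ - X]eq_bigl do rewrite addn1.
  rewrite [X in _ - X]big_mkcond /= [X in _ - X]big_ord_recr /= ltnn addr0.
  rewrite -[in RHS](addrK (\sum_(i < n) q ^+ i * chain_sum es i) (q ^+ n * _)).
  by congr (_ + _ - _); apply: eq_bigr => i _; rewrite ?ltn_ord // ltnS ltnW.
have addP (m : nat) : \sum_(c < m.+1 | (c + 0 <= m)%N) q ^+ c * chain_sum es c
  = \sum_(c < m.+1) q ^+ c * chain_sum es c.
  by apply: eq_bigl => c; rewrite addn0 -ltnS ltn_ord.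
rewrite !addP subn0; case: n => [|n]; first by rewrite subr0 big_ord1.
by rewrite !addP big_ord_recr /= [LHS]addrC addKr.
Qed.

(** Iterating [chain_sumS], the factor [t] of a strict step at index [i] undergoes [i] substitutions
    [t -> q t] and becomes [t q^i], while the factors [1 - t] build up [(t;q)]. *)
Lemma chain_sum_gf es :
  Fps (chain_sum es) * qpoch (fpsX R) (fpsC q) (size es).+1 =
  fpsX R ^+ (\sum_(i < size es) nth false es i) *
  fpsC q ^+ (\sum_(i < size es) i * nth false es i).
Proof.
elim: es => [|e es IHes].
  rewrite !big_ord0 mulr1 mulrC -qscale_qpoch /qpoch big_ord0 rmorph1 mulr1.
  apply/fpsP=> n; rewrite mulrBl mul1r fcoefD fcoefN fcoefXM.
  by case: n => [|n] /=; rewrite ?subr0 ?subrr.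
rewrite -qscale_qpoch mulrCA mulrA chain_sumS -mulrA -rmorphM /= IHes.
rewrite rmorphM !rmorphXn /= qscaleX qscaleC.
rewrite !big_ord_recl /= mul0n add0n.
under [X in _ = _ * _ ^+ X]eq_bigr do rewrite mulSn.
by rewrite big_split /= !exprD exprMn; ring.
Qed.

End Chains.

(** * Standardization of words *)

Section MacMahon.
Variable n : nat.
Implicit Types (tau sigma : 'S_n) (w : seq nat).

(* [precedes w] orders the positions of [w] by decreasing letters, equal letters
   from left to right; [sorts w tau] says that [tau] lists them in this order, so
   that [tau^-1] is the standardization of [w]. *)
Definition precedes w : rel 'I_n := fun i j =>
  ((nth 0 w j < nth 0 w i) || (nth 0 w i == nth 0 w j) && (i < j))%N.

Definition sorts w tau := sorted (precedes w) [seq tau i | i <- enum 'I_n].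

Definition reorder w tau := [seq nth 0%N w (tau i) | i <- enum 'I_n].

(** Entry [i] tells whether the step from index [i - 1] to [i] must be strict. Entry 0 is the
    comparison with the bound [r], never strict. Descent positions count from 1, so [i] is also the
    contribution to [maj]. *)
Definition descents tau : seq bool :=
  [seq (0 < i)%N && is_descent (perm_word tau) i | i <- iota 0 n].

Lemma precedes_trans w : transitive (precedes w).
Proof. by move=> j i k; rewrite /precedes; lia. Qed.

Lemma precedes_irr w : irreflexive (precedes w).
Proof. by move=> i; rewrite /precedes; lia. Qed.

Lemma nth_map_enum T (x0 : T) (f : 'I_n -> T) (i : 'I_n) :
  nth x0 [seq f j | j <- enum 'I_n] i = f i.
Proof. by rewrite (nth_map i) ?size_enum_ord // nth_ord_enum. Qed.

Lemma nth_map_enum_ord T (x0 : T) (f : 'I_n -> T) i (lt_in : (i < n)%N) :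
  nth x0 [seq f j | j <- enum 'I_n] i = f (Ordinal lt_in).
Proof. exact: (nth_map_enum x0 f (Ordinal lt_in)). Qed.

Lemma map_nth_ord w : size w = n -> [seq nth 0%N w i | i : 'I_n <- enum 'I_n] = w.
Proof.
move=> sz_w; apply: (@eq_from_nth _ 0%N); rewrite size_map size_enum_ord // => i lt_in.
exact: (nth_map_enum 0%N (fun i : 'I_n => nth 0%N w i) (Ordinal lt_in)).
Qed.

Lemma map_perm_inj tau1 tau2 :
  [seq tau1 i | i <- enum 'I_n] = [seq tau2 i | i <- enum 'I_n] -> tau1 = tau2.
Proof.
move=> e; apply/permP => i.
by rewrite -(nth_map_enum i tau1) e nth_map_enum.
Qed.

Lemma mem_map_perm tau : [seq tau i | i <- enum 'I_n] =i enum 'I_n.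
Proof.
move=> i; rewrite mem_enum; apply/mapP.
by exists ((tau^-1)%g i); rewrite ?mem_enum // permKV.
Qed.

(** Ties being broken by position, [precedes w] is a strict total order, and a finite set has one
    increasing enumeration. *)
Lemma sorts_unique w : exists tau, forall tau', sorts w tau' = (tau' == tau).
Proof.
(* Sorting uses the reflexive closure, which is total; distinctness of the entries then restores
   strictness. *)
pose le_w : rel 'I_n := fun i j => (i == j) || precedes w i j.
pose l := sort le_w (enum 'I_n).
have sz_l : size l = n by rewrite size_sort size_enum_ord.
have uniq_l : uniq l by rewrite sort_uniq enum_uniq.
have sorted_l : sorted (precedes w) l.
  have: sorted le_w l.
    apply: sort_sorted => i j; rewrite /le_w /precedes -!val_eqE /=; lia.
  move=> srt; have: sorted [rel i j | le_w i j && (i != j)] l.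
    case: (l) srt uniq_l => //= i l' srt.
    elim: l' i srt => //= j l' IHl' i /andP[-> srt].
    rewrite in_cons negb_or -andbA => /and4P[-> _ jl' ul'] /=.
    by rewrite IHl' //= jl'.
  by apply: sub_sorted => i j /=; rewrite /le_w => /andP[/predU1P[->|//]]; rewrite eqxx.
have f_inj : injective (fun i : 'I_n => nth i l i).
  move=> i j; rewrite (set_nth_default i) ?sz_l // => /eqP.
  by rewrite nth_uniq ?sz_l // => /eqP/val_inj.
exists (perm f_inj) => tau'.
have lE : [seq perm f_inj i | i <- enum 'I_n] = l.
  case: (pickP (fun _ : 'I_n => true)) => [x0 _|no]; last first.
    have nil_ord (l' : seq 'I_n) : l' = [::] by case: l' => // i; have := no i.
    by rewrite [LHS]nil_ord [RHS]nil_ord.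
  apply: (@eq_from_nth _ x0) => [|i]; rewrite size_map size_enum_ord // => lt_in.
  rewrite (nth_map_enum x0 (perm f_inj) (Ordinal lt_in)) permE /=.
  by apply: set_nth_default; rewrite sz_l.
apply/idP/eqP => [srt | ->]; last by rewrite /sorts lE.
apply: map_perm_inj; rewrite lE.
apply: irr_sorted_eq (@precedes_trans w) (@precedes_irr w) _ _ srt sorted_l _ => i.
by rewrite mem_map_perm mem_sort.
Qed.

Lemma sorts_precedes w tau (i j : 'I_n) : sorts w tau ->
  ((tau^-1)%g i < (tau^-1)%g j)%N -> precedes w i j.
Proof.
move=> srt lt_ij.
have := sorted_ltn_nth (@precedes_trans w) i srt.
rewrite size_map size_enum_ord => /(_ ((tau^-1)%g i) ((tau^-1)%g j)).
by rewrite !inE !ltn_ord lt_ij !nth_map_enum !permKV; apply.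
Qed.

(** [tau^-1] gives the rank of each position. For [i < j], position [i] has the smaller rank exactly
    when its letter is at least that of [j]. *)
Lemma sorts_pixlec w tau : size w = n -> sorts w tau ->
  pixlec geq w = (pix (tau^-1)%g, lec (tau^-1)%g).
Proof.
move=> sz_w srt; rewrite -pixlec_perm /perm_word.
rewrite -{1}(map_nth_ord sz_w).
rewrite pixlec_map [RHS]pixlec_map; apply: eq_pixlec.
have: pairwise (fun i j : 'I_n => i < j)%N (enum 'I_n).
  rewrite -(pairwise_map (@nat_of_ord n) ltn) -sorted_pairwise; last exact: ltn_trans.
  by rewrite val_enum_ord iota_ltn_sorted.
apply: sub_pairwise => i j lt_ij /=.
have [lt_t|lt_t|/val_inj/perm_inj eq_ij] := ltngtP ((tau^-1)%g i) ((tau^-1)%g j).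
- have := sorts_precedes srt lt_t; rewrite /precedes /relpre /= ltnS lt_t; lia.
- have := sorts_precedes srt lt_t; rewrite /precedes /relpre /= ltnS; lia.
- by rewrite eq_ij ltnn in lt_ij.
Qed.

Lemma size_reorder w tau : size (reorder w tau) = n.
Proof. by rewrite size_map size_enum_ord. Qed.

Lemma nth_reorder w tau (i : 'I_n) : nth 0%N (reorder w tau) i = nth 0%N w (tau i).
Proof. exact: nth_map_enum. Qed.

Lemma perm_reorder w tau : size w = n -> perm_eq (reorder w tau) w.
Proof.
move=> sz_w; rewrite -{2}(map_nth_ord sz_w).
rewrite /reorder (map_comp (fun i : 'I_n => nth 0%N w i) tau); apply: perm_map.
apply: uniq_perm; rewrite ?enum_uniq //; last exact: mem_map_perm.
by rewrite map_inj_uniq ?enum_uniq //; apply: perm_inj.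
Qed.

(** Rearranging positions by [tau] is injective and keeps the letters, hence permutes the finite
    list of words. *)
Lemma perm_reorder_words r tau :
  perm_eq [seq reorder w tau | w <- words r n] (words r n).
Proof.
have uniq_l : uniq [seq reorder w tau | w <- words r n].
  rewrite map_inj_in_uniq ?uniq_words // => w1 w2.
  rewrite !mem_words => /andP[/eqP s1 _] /andP[/eqP s2 _] e12.
  apply: (@eq_from_nth _ 0%N) => [|i]; first by rewrite s1.
  rewrite s1 => lt_in; rewrite -[i]/(val (Ordinal lt_in)).
  by rewrite -[Ordinal lt_in](permKV tau) -!nth_reorder e12.
apply: uniq_perm (uniq_words r n) _ => //.
apply: (uniq_min_size uniq_l _ _).2; last by rewrite size_map.
move=> _ /mapP[w hw ->]; move: hw; rewrite !mem_words => /andP[/eqP sw aw].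
by rewrite size_reorder eqxx (perm_all _ (perm_reorder tau sw)).
Qed.

(** Equal letters are listed from left to right, so the letter has to drop strictly exactly where
    [tau] descends. *)
Lemma precedes_step w tau (i j : 'I_n) : j = i.+1 :> nat ->
  precedes w (tau i) (tau j) =
  (nth 0 (reorder w tau) j + nth false (descents tau) j <= nth 0 (reorder w tau) i)%N.
Proof.
move=> ji; rewrite !nth_reorder (nth_map 0%N) ?size_iota // nth_iota // add0n.
rewrite /is_descent /perm_word {1}ji /= nth_map_enum.
rewrite [in nth 0%N _ j.-1]ji /= nth_map_enum ltnS /precedes.
have: tau i != tau j by rewrite (inj_eq perm_inj) -val_eqE /= ji; lia.
rewrite -val_eqE /=; lia.
Qed.

Lemma sorts_chain r w tau : size w = n -> all (fun a => a <= r)%N w ->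
  sorts w tau = chain r (descents tau) (reorder w tau).
Proof.
move=> sz_w le_w.
have sz_d : size (descents tau) = size (reorder w tau).
  by rewrite size_map size_iota size_reorder.
have le_r (i : 'I_n) : (nth 0 (reorder w tau) i <= r)%N.
  have: all (fun a => a <= r)%N (reorder w tau) by rewrite (perm_all _ (perm_reorder tau sz_w)).
  by move/all_nthP; apply; rewrite size_reorder.
apply/idP/(chainP _ sz_d) => [srt i | H].
  (* Index 0 is the comparison with [r]; the others compare neighbours. *)
  rewrite size_reorder => lt_in; case: i lt_in => [|i] lt_in.
    rewrite (nth_map 0%N) ?size_iota // nth_iota // ltnn.
    by rewrite andFb [X in (X <= _)%N]addn0; apply: (le_r (Ordinal lt_in)).
  have step := @precedes_step w tau (Ordinal (ltnW lt_in)) (Ordinal lt_in) erefl.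
  rewrite [nth 0%N (_ :: _) _]/= -[X in is_true X]step.
  move/(sortedP (Ordinal lt_in)): srt => /(_ i).
  rewrite size_map size_enum_ord => /(_ lt_in).
  rewrite (nth_map_enum_ord (Ordinal lt_in) tau (ltnW lt_in)).
  by rewrite (nth_map_enum_ord (Ordinal lt_in) tau lt_in).
case: (posnP n) => [n0|n_gt0].
  rewrite /sorts; case: map (size_map tau (enum 'I_n)) => // i l.
  by have := ltn_ord i; lia.
apply/(sortedP (Ordinal n_gt0)) => i; rewrite size_map size_enum_ord => lt_in.
rewrite (nth_map_enum_ord (Ordinal n_gt0) tau (ltnW lt_in)).
rewrite (nth_map_enum_ord (Ordinal n_gt0) tau lt_in).
by rewrite precedes_step //; apply: (H i.+1); rewrite size_reorder.
Qed.

Section Sums.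
Variables (R : comNzRingType) (s q Y : R).

(** Words are grouped by standardization [sigma], which fixes [pix] and [lec]; rearranged by
    [sigma^-1], each group becomes the chains below [r]. *)
Lemma sum_words_perm r :
  \sum_(w <- words r n) word_weight s q Y w =
  \sum_sigma s ^+ lec sigma * Y ^+ pix sigma * chain_sum q (descents (sigma^-1)%g) r.
Proof.
transitivity (\sum_(w <- words r n) \sum_(tau | sorts w tau) word_weight s q Y w).
  apply: eq_bigr => w _; have [tau tauP] := sorts_unique w.
  by rewrite (big_pred1 tau).
rewrite (exchange_big_dep xpredT) //= (reindex_inj invg_inj).
apply: eq_bigr => sigma _; set tau := (sigma^-1)%g.
have sz_d : size (descents tau) = n by rewrite size_map size_iota.
rewrite -(sum_words_chain q _ (leqnn r)) sz_d -[in RHS](perm_big _ (perm_reorder_words r tau)).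
rewrite big_map mulr_sumr big_seq_cond [RHS]big_seq_cond.
apply: eq_big => [w|w].
  rewrite mem_words; case sz_w: (_ == _) => //=; case le_w: (all _ _) => //=.
  by rewrite (sorts_chain tau (eqP sz_w) le_w).
rewrite mem_words => /andP[/andP[/eqP sz_w le_w] srt].
rewrite /word_weight (sorts_pixlec sz_w srt) invgK /=.
by rewrite (perm_sumn (perm_reorder tau sz_w)); ring.
Qed.

Lemma descents_gf tau :
  Fps (chain_sum q (descents tau)) * qpoch (fpsX R) (fpsC q) n.+1 =
  fpsX R ^+ des tau * fpsC q ^+ maj tau.
Proof.
have sz_d : size (descents tau) = n by rewrite size_map size_iota.
(* Taking [F] constant to 1 gives [des], and [F] the identity gives [maj]. *)
have dE (F : nat -> nat) : (\sum_(i < n) F i * nth false (descents tau) i =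
  \sum_(1 <= i < n | is_descent (perm_word tau) i) F i)%N.
  transitivity (\sum_(i < n | (0 < i) && is_descent (perm_word tau) i) F i)%N.
    rewrite [RHS]big_mkcond; apply: eq_bigr => i _.
    rewrite (nth_map 0%N) ?size_iota // nth_iota // add0n.
    by case: andb; rewrite ?muln1 ?muln0.
  case: (n) tau {sz_d} => [|m] tau; first by rewrite big_ord0 big_geq.
  rewrite -(big_mkord (fun i => (0 < i)%N && is_descent (perm_word tau) i) F).
  rewrite big_mkcond big_ltn //= add0n [RHS]big_mkcond.
  by apply: eq_big_nat => i /andP[i0 _]; rewrite i0.
have sz_p : size (perm_word tau) = n by rewrite size_map size_enum_ord.
have := chain_sum_gf q (descents tau); rewrite sz_d => ->.
rewrite /des /maj /desw /majw sz_p -!dE; congr (_ ^+ _ * _).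
by apply: eq_bigr => i _; rewrite mul1n.
Qed.

End Sums.
End MacMahon.

(** * The identity of power series *)

Section Evaluation.
Variables (K : fieldType) (phi : {rmorphism {mpoly int[3]} -> K}).
Hypothesis phi_inj : injective phi.

Let s := phi 'X_(inord 0).
Let q := phi 'X_(inord 1).
Let Y := phi 'X_(inord 2).

Definition eval_t (P : {mpoly int[4]}) : {fps K} :=
  mmap intr (tnth [tuple fpsC s; fpsX K; fpsC q; fpsC Y]) P.

Lemma eval_t_monomial a b c d :
  eval_t (ps ^+ a * pt ^+ b * pq ^+ c * pY ^+ d) =
  fpsC (s ^+ a * Y ^+ d) * (fpsX K ^+ b * fpsC q ^+ c).
Proof.
rewrite /eval_t /ps /pt /pq /pY !rmorphM !rmorphXn /= !mmapX !mmap1U.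
by rewrite !(tnth_nth 0) /= !inordK //=; ring.
Qed.

(* The exponents of s, q and Y, without the one of t. *)
Let drop_t (m : 'X_{1..4}) : 'X_{1..3} :=
  [multinom nth 0%N [:: m (inord 0); m (inord 2); m (inord 3)] i | i < 3].

Let drop_t_inj m1 m2 : drop_t m1 = drop_t m2 -> m1 (inord 1) = m2 (inord 1) -> m1 = m2.
Proof.
move=> /mnmP e e1; apply/mnmP => -[i lt_i].
move: (e (inord 0)) (e (inord 1)) (e (inord 2)).
rewrite !mnmE !inordK //= => e0 e2 e3.
have inordE j (lt_j : (j < 4)%N) : Ordinal lt_j = inord j by apply: val_inj; rewrite /= inordK.
by do 4?[case: i lt_i => [|i] lt_i; first by rewrite inordE]; case: notF; move: lt_i.
Qed.

Let prod4 (R : comNzRingType) (F : 'I_4 -> R) :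
  \prod_(i < 4) F i = F (inord 0) * F (inord 1) * F (inord 2) * F (inord 3).
Proof.
rewrite !big_ord_recl big_ord0 mulr1 !mulrA.
by congr (F _ * F _ * F _ * F _); apply: val_inj; rewrite /= inordK.
Qed.

Let prod3 (R : comNzRingType) (F : 'I_3 -> R) :
  \prod_(i < 3) F i = F (inord 0) * F (inord 1) * F (inord 2).
Proof.
rewrite !big_ord_recl big_ord0 mulr1 !mulrA.
by congr (F _ * F _ * F _); apply: val_inj; rewrite /= inordK.
Qed.

Let mmap1_t m : mmap1 (tnth [tuple fpsC s; fpsX K; fpsC q; fpsC Y]) m =
  fpsX K ^+ m (inord 1) * fpsC (phi 'X_[drop_t m]).
Proof.
rewrite mpolyXE_id /mmap1 prod4 prod3 !rmorphM !rmorphXn /= !mnmE !(tnth_nth 0) /= !inordK //=.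
rewrite -/s -/q -/Y; ring.
Qed.

(** The coefficient of [t^b] in [eval_t P] is the image under [phi] of the part of [P] of degree [b]
    in [t]. Injectivity of [phi] then isolates each monomial, determined by [b] and [drop_t]. *)
Lemma eval_t_eq0 P : eval_t P = 0 -> P = 0.
Proof.
move=> P0; apply/eqP; rewrite -msupp_eq0; apply: contraT => nz.
have [m0 m0P] : exists m0, m0 \in msupp P.
  by case: (msupp P : seq _) nz => // m l _; exists m; rewrite mem_head.
have := congr1 (fun f => fcoef f (m0 (inord 1))) P0.
rewrite /eval_t /mmap fcoef_sum fcoef0.
under eq_bigr => m _.
  rewrite mmap1_t -(rmorph_int (@fpsC K)) fcoefCM fcoefXnM -(rmorph_int phi).
  have -> : (if (m (inord 1) <= m0 (inord 1))%N then
      fcoef (fpsC (phi 'X_[drop_t m])) (m0 (inord 1) - m (inord 1)) else 0) =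
    phi (if m (inord 1) == m0 (inord 1) then 'X_[drop_t m] else 0).
    rewrite (fun_if phi) rmorph0 /= subn_eq0 eqn_leq.
    by case: leqP; rewrite ?andbT ?andbF //=; case: leqP.
  rewrite -rmorphM; over.
rewrite -rmorph_sum -(rmorph0 phi) => /phi_inj/(congr1 (mcoeff (drop_t m0))).
rewrite raddf_sum mcoeff0 /= (bigD1_seq m0) ?msupp_uniq //= big1 => [|m neq_m].
  rewrite addr0 eqxx mulrzl raddfMz /= mcoeffX eqxx intz => P0'.
  by move: m0P; rewrite mcoeff_msupp P0' eqxx.
case: eqP => [e1|_]; last by rewrite mulr0 mcoeff0.
rewrite mulrzl raddfMz /= mcoeffX; case: eqP => [e|]; last by rewrite mul0rz.
by case/eqP: neq_m; apply: drop_t_inj.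
Qed.

Lemma eval_t_inj : injective eval_t.
Proof.
move=> P1 P2 eqP12; apply/eqP; rewrite -subr_eq0; apply/eqP/eval_t_eq0.
by rewrite /eval_t raddfB /= -![mmap _ _ _]/(eval_t _) eqP12 subrr.
Qed.

End Evaluation.

Lemma rmorph_mmap_intr n (R S : comNzRingType) (f : {rmorphism R -> S})
    (h : 'I_n -> R) (P : {mpoly int[n]}) :
  mmap intr (f \o h) P = f (mmap intr h P).
Proof.
rewrite /mmap rmorph_sum; apply: eq_bigr => m _.
rewrite rmorphM rmorph_int /mmap1 rmorph_prod; congr (_ * _).
by apply: eq_bigr => i _; rewrite rmorphXn.
Qed.

(** * Both sides as one series over words, and uniqueness *)

Section Identity.

Let phi : {rmorphism {mpoly int[3]} -> coefField} := (@tofrac {mpoly int[3]}).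

Let phi_inj : injective phi.
Proof. by move=> a b /eqP; rewrite /phi /= tofrac_eq => /eqP. Qed.

Let s : coefField := phi 'X_(inord 0).
Let q : coefField := phi 'X_(inord 1).
Let Y : coefField := phi 'X_(inord 2).

Let W n r := \sum_(w <- words r n) word_weight s q Y w.

(** The common sum of both sides: words of length [n] give the power of [u], and the bound on their
    letters the power of [t]. *)
Definition hook_series : series := Fps (fun n => Fps (W n)).

Lemma lhs_termE r :
  lhs_term r = fpsC (fpsX coefField ^+ r) * wordsGF (fpsC s) (fpsC q) (fpsC Y) r.
Proof.
rewrite /lhs_term rmorphXn; congr (_ * _).
apply: (canLR (mulrK (lhs_den_unit r))); apply/esym.
exact: (wordsGFE (fpsC s) (fpsC q) (fpsC Y) r).
Qed.

Lemma fcoef_wordsGF r n :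
  fcoef (wordsGF (fpsC s) (fpsC q) (fpsC Y) r) n = fpsC (W n r).
Proof.
rewrite rmorph_sum /=; apply: eq_bigr => w _.
by rewrite /word_weight !rmorphM !rmorphXn.
Qed.

Lemma lhs_sums_to : sums_to lhs_term hook_series.
Proof.
move=> n j; exists j.+1 => M lt_jM.
rewrite /coefS !fcoef_sum.
(* The factor [t^r] multiplies a series free of [t], so only [r = j] contributes. *)
transitivity (\sum_(r < M | r == j :> nat) W n r).
  rewrite [RHS]big_mkcond; apply: eq_bigr => r _.
  rewrite lhs_termE fcoefCM fcoef_wordsGF fcoefXnM /= subn_eq0 eqn_leq.
  by case: (r <= j)%N.
by rewrite (big_ord1_eq _ (W n)) lt_jM.
Qed.

Lemma sums_to_unique F S1 S2 :
  sums_to F S1 -> sums_to F S2 -> forall i j, coefS S1 i j = coefS S2 i j.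
Proof.
move=> F1 F2 i j; have [N1 S1E] := F1 i j; have [N2 S2E] := F2 i j.
by rewrite -(S1E (maxn N1 N2)) ?leq_maxl // -(S2E (maxn N1 N2)) ?leq_maxr.
Qed.

Let den n := qpoch (fpsX coefField) (fpsC q) n.

Let den_unit n : den n \is a GRing.unit.
Proof.
rewrite fps_unitE; apply/unitrPr; exists 1; rewrite mulr1 /den /qpoch.
elim: n => [|n IHn]; first by rewrite big_ord0.
rewrite big_ord_recr fcoefM big_ord1 IHn mul1r fcoefD fcoefN fcoefXM subr0.
by [].
Qed.

Lemma fpsC_qpoch n : qpoch tS qS n = fpsC (den n).
Proof.
rewrite /qpoch rmorph_prod; apply: eq_bigr => i _.
by rewrite rmorphB rmorph1 rmorphM rmorphXn.
Qed.

Lemma rhs_termE B n :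
  rhs_term B n = fpsC (eval_t phi (B n) / den n.+1) * uS ^+ n.
Proof.
have polyE : series_of_poly (B n) = fpsC (eval_t phi (B n)).
  rewrite /series_of_poly /eval_t -rmorph_mmap_intr.
  congr (mmap _ _ (B n)); apply/boolp.funext => i /=; rewrite !(tnth_nth 0).
  by case: i => [[|[|[|[|i]]]]].
have invE : (qpoch tS qS n.+1)^-1 = fpsC (den n.+1)^-1.
  by rewrite fpsC_qpoch; apply/esym/rmorphV/den_unit.
rewrite /rhs_term polyE invE mulrCA mulrC; congr (_ * _); apply/esym/rmorphM.
Qed.

Lemma coefS_rhs B n j M : (n < M)%N ->
  coefS (\sum_(m < M) rhs_term B m) n j = fcoef (eval_t phi (B n) / den n.+1) j.
Proof.
move=> lt_nM; rewrite /coefS !fcoef_sum.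
pose c m := fcoef (eval_t phi (B m) / den m.+1) j.
transitivity (\sum_(m < M | m == n :> nat) c m); last by rewrite big_ord1_eq lt_nM.
rewrite [RHS]big_mkcond; apply: eq_bigr => m _.
rewrite rhs_termE fcoefCM -[uS ^+ m]mulr1 fcoefXnM fcoef1 subn_eq0 eqn_leq /c.
case: (m <= n)%N; rewrite ?andTb ?andFb ?mulr0 //.
by case: (n <= m)%N; rewrite ?mulr1 ?mulr0.
Qed.

Lemma sums_to_rhs B S : sums_to (rhs_term B) S ->
  forall n j, coefS S n j = fcoef (eval_t phi (B n) / den n.+1) j.
Proof.
move=> BS n j; have [N SE] := BS n j.
by rewrite -(SE (maxn N n.+1)) ?leq_maxl // coefS_rhs // leq_maxr.
Qed.

Definition hook_poly n : {mpoly int[4]} := \sum_(sigma : 'S_n)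
  ps ^+ lec sigma * pt ^+ ides sigma * pq ^+ imaj sigma * pY ^+ pix sigma.

(** [descents_gf] at [sigma^-1] clears the denominator and yields [ides] and [imaj]. *)
Lemma eval_hook_poly n : eval_t phi (hook_poly n) = Fps (W n) * den n.+1.
Proof.
have -> : Fps (W n) = \sum_(sigma : 'S_n) fpsC (s ^+ lec sigma * Y ^+ pix sigma) *
    Fps (chain_sum q (descents (sigma^-1)%g)).
  apply/fpsP => r; rewrite fcoef_sum [LHS]sum_words_perm.
  by apply: eq_bigr => sigma _; rewrite fcoefCM.
rewrite mulr_suml /hook_poly /eval_t rmorph_sum; apply: eq_bigr => sigma _.
rewrite -[RHS]mulrA; apply: etrans (eval_t_monomial phi _ _ _ _) _.
congr (_ * _); apply/esym; exact: descents_gf.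
Qed.

Lemma rhs_sums_to : sums_to (rhs_term hook_poly) hook_series.
Proof.
move=> n j; exists n.+1 => M lt_nM.
by rewrite coefS_rhs // eval_hook_poly mulrK.
Qed.

(** The left side has only one sum, which fixes each coefficient in [u] on the right; the
    denominators are units and [eval_t] is injective. *)
Lemma generating_identity_unique B : generating_identity B -> forall n, B n = hook_poly n.
Proof.
move=> [S [S_lhs S_rhs]] n.
apply: (eval_t_inj phi_inj); apply: (divIr (den_unit n.+1)).
apply: (fpsP _ _).1 => j.
apply: etrans (esym (sums_to_rhs S_rhs n j)) _.
apply: etrans (sums_to_rhs rhs_sums_to n j).
exact: (sums_to_unique S_lhs lhs_sums_to n j).
Qed.

End Identity.

Theorem theorem1p2 :
  exists A : nat -> {mpoly int[4]},
    generating_identity A /\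
    (forall B : nat -> {mpoly int[4]},
        generating_identity B -> forall n : nat, B n = A n) /\
    forall n : nat,
      \sum_(sigma : 'S_n)
         ps ^+ lec sigma * pt ^+ ides sigma * pq ^+ imaj sigma * pY ^+ pix sigma
      = A n.
Proof.
exists hook_poly; split; last by split=> //; apply: generating_identity_unique.
by exists hook_series; split; [exact: lhs_sums_to | exact: rhs_sums_to].
Qed.
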